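(* Let $\beta\in(1,+\infty)\setminus\mathbb{N}$ and let $\overline{p}=(\overline{p}_0,\dots,\overline{p}_{\lfloor\beta\rfloor}),\ \underline{p}=(\underline{p}_0,\dots,\underline{p}_{\lfloor\beta\rfloor})\in[0,1]^{\lceil\beta\rceil}$. Then Lebesgue almost every $x\in I_\beta$ has a $\beta$-expansion of frequency $(\overline{p},\underline{p})$ if and only if Lebesgue almost every $x\in I_\beta$ has infinitely many $\beta$-expansions of frequency $(\overline{p},\underline{p})$.
   Context: $\mathbb{N}=\{1,2,3,\dots\}$; $\lfloor\beta\rfloor$ is the greatest integer $\le\beta$ and $\lceil\beta\rceil$ the smallest integer $\ge\beta$. For a non-integer $\beta>1$, the alphabet is $\mathcal{A}_\beta=\{0,1,\dots,\lfloor\beta\rfloor\}$ (which has $\lceil\beta\rceil$ elements) and $I_\beta=[0,\frac{\lfloor\beta\rfloor}{\beta-1}]$. A $\beta$-expansion of $x\in\mathbb{R}$ is a sequence $(\epsilon_i)_{i\ge1}\in\mathcal{A}_\beta^{\mathbb{N}}$ with $x=\sum_{i=1}^\infty \epsilon_i\beta^{-i}$. For a sequence $(\epsilon_i)_{i\ge1}\in\{0,1,\dots,m\}^{\mathbb{N}}$ and a digit $k\in\{0,\dots,m\}$, the upper-frequency and lower-frequency of $k$ are $$\overline{\mathrm{Freq}}_k(\epsilon_i)=\limsup_{n\to\infty}\frac{\#\{1\le i\le n:\epsilon_i=k\}}{n},\qquad \underline{\mathrm{Freq}}_k(\epsilon_i)=\liminf_{n\to\infty}\frac{\#\{1\le i\le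 n:\epsilon_i=k\}}{n}.$$ For $\overline{p}=(\overline{p}_0,\dots,\overline{p}_m)$ and $\underline{p}=(\underline{p}_0,\dots,\underline{p}_m)$ in $[0,1]^{m+1}$, the sequence $(\epsilon_i)_{i\ge1}$ is said to be of frequency $(\overline{p},\underline{p})$ if $\overline{\mathrm{Freq}}_k(\epsilon_i)=\overline{p}_k$ and $\underline{\mathrm{Freq}}_k(\epsilon_i)=\underline{p}_k$ for all $k\in\{0,1,\dots,m\}$. Here this is applied with $m=\lfloor\beta\rfloor$. *)

(* Defs.v *)
From HB Require Import structures.
From mathcomp Require Import all_boot all_order all_algebra.
From mathcomp Require Import all_classical all_reals all_analysis.

Set Implicit Arguments.
Unset Strict Implicit.
Unset Printing Implicit Defensive.

Import Order.TTheory GRing.Theory Num.Theory.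
Import numFieldNormedType.Exports.

Local Open Scope classical_set_scope.
Local Open Scope ring_scope.

(* All sequences (eps_i)_(i >= 1) are indexed from 0: [eps i] is the digit
   written eps_(i+1) in the usual numbering. *)

Section Frequencies.
Context {R : realType} {m : nat}.
Implicit Types (eps : nat -> 'I_m.+1) (k : 'I_m.+1).

(* At n = 0 the value is 0 / 0 = 0, which does not affect limsup or liminf. *)
Definition digit_freq eps k : R^nat :=
  fun n => #|[pred i : 'I_n | eps i == k]|%:R / n%:R.

(* [limn_sup] and [limn_inf] are the genuine limsup and liminf here because
   [digit_freq eps k] takes its values in [0, 1]. *)
Definition upper_freq eps k : R := limn_sup (digit_freq eps k).

Definition lower_freq eps k : R := limn_inf (digit_freq eps k).

Definition of_frequency (pup plow : 'I_m.+1 -> R) eps : Prop :=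
  forall k, upper_freq eps k = pup k /\ lower_freq eps k = plow k.

End Frequencies.

Section BetaExpansions.
Context {R : realType}.
Implicit Types beta x : R.

(* For beta >= 0, [Num.truncn beta : nat] is the floor of beta. *)
Definition digit beta : Type := 'I_(Num.truncn beta).+1.

Definition Ibeta beta : set R :=
  `[0, (Num.truncn beta)%:R / (beta - 1)]%classic.

Definition beta_expansion beta x (eps : nat -> digit beta) : Prop :=
  series (fun i => (eps i)%:R * beta ^- i.+1) @ \oo --> x.

Definition beta_expansions_of_frequency beta (pup plow : digit beta -> R) x :
    set (nat -> digit beta) :=
  [set eps | beta_expansion x eps /\ of_frequency pup plow eps].

End BetaExpansions.

(* Main.v *)
(* Write T_k x = beta x - k. Prepending k to an expansion of T_k x gives an
   expansion of x with the same digit frequencies, and on an interval S both T_0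
   and T_1 map into I_beta. Almost every x reaches S under some composition of
   the T_k staying in I_beta: the points within distance C beta^-n of x having
   an n-step image in S contain an interval of length c beta^-n, so by the
   Lebesgue density theorem the set of points never reaching S is null. If
   almost every point has an expansion of the given frequency, then, preimages
   of null sets under the affine maps T_k being null, for almost every x so do
   all the points of I_beta reachable from x. Following an orbit to S and
   continuing with both digits there then produces arbitrarily many expansions
   of the given frequency. *)

Require Import Defs.
From HB Require Import structures.
From mathcomp Require Import all_boot all_order all_algebra.
From mathcomp Require Import all_classical all_reals all_analysis.
From mathcomp Require Import measurable_realfun.
From mathcomp Require Import lra ring.

Set Implicit Arguments.
Unset Strict Implicit.
Unset Printing Implicit Defensive.

Import Order.TTheory GRing.Theory Num.Theory.
Import numFieldNormedType.Exports.

Local Open Scope classical_set_scope.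
Local Open Scope ring_scope.

(** * Prepending a digit, and counting expansions by finite lists *)

Definition scons {T} (a : T) (eps : nat -> T) : nat -> T :=
  fun n => if n is n'.+1 then eps n' else a.

Lemma scons_inj (T : Type) (a : T) : injective (scons a).
Proof.
by move=> e e' /funeqP ee'; apply/funext => n; exact: (ee' n.+1).
Qed.

(** This form suits an induction that puts one new expansion in front of a list. *)
Definition at_least (T : eqType) (n : nat) (E : set T) : Prop :=
  exists s : seq T, [/\ uniq s, size s = n & [set` s] `<=` E].

Lemma infinite_at_least (T : choiceType) (E : set T) :
  (forall n, at_least n E) -> infinite_set E.
Proof.
move=> Ealn /finite_seqP[s Es].
have [t [ut tn]] := Ealn (size s).+1.
rewrite Es => ts; have := uniq_leq_size ut ts.
by rewrite tn ltnn.
Qed.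

(** * Limsup and liminf under shifts and vanishing perturbations *)

Section LimnSup.
Context {R : realType}.
Implicit Types u v : R^nat.

Lemma limn_sup_shift u : bounded_fun u ->
  limn_sup (fun n => u n.+1) = limn_sup u.
Proof.
move=> bu.
have cu := cvg_sups_inf (bounded_fun_has_ubound bu) (bounded_fun_has_lbound bu).
rewrite /limn_sup (cvg_lim _ cu)//.
have -> : sups (fun n => u n.+1) = [sequence sups u n.+1]_n.
  apply/funext => n; rewrite /sups /=; congr sup; apply/seteqP; split=> x /=.
    by case=> j /= nj <-; exists j.+1.
  by case=> -[//|j] /= nj <-; exists j.
by apply: cvg_lim => //; move: cu; rewrite -cvg_shiftS; exact.
Qed.

Lemma limn_inf_shift u : bounded_fun u ->
  limn_inf (fun n => u n.+1) = limn_inf u.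
Proof.
move=> bu.
have cu := cvg_infs_sup (bounded_fun_has_ubound bu) (bounded_fun_has_lbound bu).
rewrite /limn_inf (cvg_lim _ cu)//.
have -> : infs (fun n => u n.+1) = [sequence infs u n.+1]_n.
  apply/funext => n; rewrite /infs /=; congr inf; apply/seteqP; split=> x /=.
    by case=> j /= nj <-; exists j.+1.
  by case=> -[//|j] /= nj <-; exists j.
by apply: cvg_lim => //; move: cu; rewrite -cvg_shiftS; exact.
Qed.

Lemma eq_limn_sup_inf u v : bounded_fun u -> bounded_fun v ->
  (fun n => u n - v n) @ \oo --> (0 : R) ->
  limn_sup u = limn_sup v /\ limn_inf u = limn_inf v.
Proof.
move=> + + uv0.
(* The hypotheses are symmetric in [u] and [v], so one inequality for each limit suffices; it
   follows from subadditivity of limsup and superadditivity of liminf for u = v + (u - v). *)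
wlog suff le_lim : u v uv0 / bounded_fun u -> bounded_fun v ->
    limn_sup u <= limn_sup v /\ limn_inf v <= limn_inf u.
  move=> bu bv; have [su iu] := le_lim _ _ uv0 bu bv.
  have [|sv iv] := le_lim v u _ bv bu.
    rewrite -oppr0 (_ : (fun n => v n - u n) = - (fun n => u n - v n)).
      exact: cvgN.
    by apply/funext => n /=; rewrite -[RHS]/(- (u n - v n)) opprB.
  by split; apply/eqP; rewrite eq_le; apply/andP.
move=> bu bv.
have [i0 s0] := cvg_limn_inf_sup uv0.
have bd : bounded_fun (fun n => u n - v n).
  by apply: cvg_seq_bounded; apply/cvg_ex; exists 0.
have uE : u = v \+ (fun n => u n - v n).
  by apply/funext => n /=; rewrite addrC subrK.
split; rewrite [in X in is_true X]uE.
  by rewrite -[leRHS]addr0 -s0; exact: le_limn_supD.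
by rewrite -[leLHS]addr0 -i0; exact: le_limn_infD.
Qed.

End LimnSup.

(** * Digit frequencies after prepending a digit *)

Section SconsFrequency.
Context {R : realType} {m : nat}.
Implicit Types (eps : nat -> 'I_m.+1) (k : 'I_m.+1).

Lemma digit_freq_ge0_le1 eps k n : 0 <= digit_freq (R := R) eps k n <= 1.
Proof.
rewrite /digit_freq divr_ge0//=; case: n => [|n]; first by rewrite invr0 mulr0.
by rewrite ler_pdivrMr// mul1r ler_nat (leq_trans (max_card _))// card_ord.
Qed.

Lemma bounded_digit_freq eps k : bounded_fun (digit_freq eps k : R^nat).
Proof.
exists 1; split => // M M1 n _.
have /andP[f0 f1] := digit_freq_ge0_le1 eps k n.
by rewrite /= ger0_norm// (le_trans f1)// ltW.
Qed.

Lemma digit_freq_scons a eps k n :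
  digit_freq (scons a eps) k n.+1 =
  ((a == k)%:R + n%:R * digit_freq eps k n) / n.+1%:R :> R.
Proof.
rewrite /digit_freq -!sum1_card big_mkcond/= big_ord_recl/= natrD.
congr ((_ + _) / _).
(* For n = 0 the quotient n / n is 0 rather than 1, but the count is then 0 as well. *)
rewrite mulrCA; case: n => [|n]; first by rewrite !big_ord0 mul0r.
by rewrite divff ?pnatr_eq0// mulr1 [in RHS]big_mkcond.
Qed.

(** The difference is ([a = k] - f) / (n + 1) with f in [0, 1], hence at most 1 / (n + 1) in
    absolute value. *)
Lemma cvg_digit_freq_scons a eps k :
  (fun n => digit_freq (scons a eps) k n.+1 - digit_freq eps k n) @ \oo -->
    (0 : R).
Proof.
apply: (@squeeze_cvgr _ _ _ _ (fun n => - harmonic n) harmonic).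
- apply: nearW => n; rewrite -ler_norml digit_freq_scons.
  have /andP[f0 f1] := digit_freq_ge0_le1 eps k n.
  have -> : ((a == k)%:R + n%:R * digit_freq eps k n) / n.+1%:R -
      digit_freq eps k n = ((a == k)%:R - digit_freq eps k n) / n.+1%:R :> R.
    have : n.+1%:R != 0 :> R by rewrite pnatr_eq0.
    rewrite -natr1 => n0; field; exact: n0.
  rewrite /harmonic /= normrM [X in _ * X]ger0_norm// ler_piMl//.
  move: f0 f1; rewrite ler_norml; move: (digit_freq eps k n) => f f0 f1.
  by case: (a == k) => /=; apply/andP; split; lra.
- by rewrite -oppr0; apply: cvgN; exact: cvg_harmonic.
- exact: cvg_harmonic.
Qed.

Lemma of_frequency_scons (pup plow : 'I_m.+1 -> R) a eps :
  of_frequency pup plow eps -> of_frequency pup plow (scons a eps).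
Proof.
move=> freq k; have [<- <-] := freq k.
have [|sE iE] := eq_limn_sup_inf _ (bounded_digit_freq eps k)
  (cvg_digit_freq_scons a eps k).
  have [M [Mr bM]] := bounded_digit_freq (scons a eps) k.
  by exists M; split=> // x xM n _; exact: bM.
rewrite /upper_freq /lower_freq -sE -iE.
by rewrite limn_sup_shift ?limn_inf_shift//; exact: bounded_digit_freq.
Qed.

End SconsFrequency.

(** * Lebesgue measure under affine maps *)

Lemma measurable_affine {R : realType} (a b : R) :
  measurable_fun setT
    (fun x : measurableTypeR R => a * x - b : measurableTypeR R).
Proof. by apply: measurable_funB => //; apply: measurable_funM. Qed.

(** The right-hand side is a measure in [A] giving each half-open interval its length, so uniqueness
    of Lebesgue measure applies. *)
Lemma lebesgue_measure_preimage_affine {R : realType} (a b : R)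
    (A : set (measurableTypeR R)) : 0 < a -> measurable A ->
  lebesgue_measure A =
  (a%:E * lebesgue_measure ((fun x : R => (a * x - b)%R) @^-1` A))%E.
Proof.
move=> a0 mA; pose aN := NngNum (ltW a0).
have maff := measurable_affine a b.
apply: (lebesgue_measure_unique (mu := mscale aN (pushforward lebesgue_measure
  (fun x : measurableTypeR R => a * x - b : measurableTypeR R)))) => //.
move=> _ [[c d]] _ <-.
rewrite /= /mscale /= /pushforward.
rewrite [X in (_ * lebesgue_measure X)%E](_ : _ =
    `](c + b) / a, (d + b) / a]%classic); last first.
  by apply/seteqP; split=> x /=;
    rewrite !in_itv/= ltr_pdivrMr// ler_pdivlMr// ltrBrDr lerBlDr mulrC.
rewrite !lebesgue_measure_itv/= !lte_fin ltr_pM2r ?invr_gt0// ltrD2r.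
case: ifPn => _; last by rewrite mule0.
by rewrite -!EFinD -EFinM; congr _%:E; field; rewrite gt_eqF.
Qed.

Lemma negligible_preimage_affine {R : realType} (a b : R) (N : set R) : 0 < a ->
  (@lebesgue_measure R).-negligible N ->
  (@lebesgue_measure R).-negligible ((fun x => a * x - b) @^-1` N).
Proof.
move=> a0 [A [mA A0 NA]]; exists ((fun x => a * x - b) @^-1` A); split.
- by rewrite -[X in measurable X]setTI; exact: measurable_affine.
- have /esym/eqP := lebesgue_measure_preimage_affine b a0 mA.
  by rewrite A0 mule_eq0 eqe gt_eqF//= => /eqP.
- by move=> x; exact: NA.
Qed.

(** * The maps T_k on I_beta and the switch region *)

Section BetaMaps.
Context {R : realType} (beta : R).
Hypothesis beta_gt1 : 1 < beta.

Let beta_gt0 : 0 < beta. Proof. exact: lt_trans beta_gt1. Qed.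

Let L : R := (Num.truncn beta)%:R / (beta - 1).

Definition beta_map (k : digit beta) (x : R) : R := beta * x - k%:R.

Definition beta_preimage (A : set R) : set R :=
  [set x | exists k, A (beta_map k x)].

(** Used in two opposite roles: for a null [N] it holds the good points, for [switch_region] it is
    the exceptional set. *)
Definition beta_orbit_avoid (N : set R) : set R :=
  Ibeta beta `\` \bigcup_n iter n beta_preimage N.

(** The endpoints encode T_1 x >= 0 and T_0 x <= L. *)
Definition switch_region : set R := `[beta^-1, L / beta]%classic.

(** This amounts to beta < floor(beta) + 1; it gives the switch region its positive length (L - 1) /
    beta. *)
Lemma Ibeta_length_gt1 : 1 < L.
Proof.
rewrite /L ltr_pdivlMr ?subr_gt0// mul1r ltrBlDr natr1.
have /andP[_] := truncn_itv (ltW beta_gt0); exact.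
Qed.

Let LE : beta * L = L + (Num.truncn beta)%:R.
Proof. by rewrite /L; field; rewrite subr_eq0 gt_eqF. Qed.

Let Ibeta_itv x : Ibeta beta x <-> 0 <= x <= L.
Proof. by rewrite /Ibeta /= in_itv. Qed.

(** The ends 0 and L are the fixed points of the first and last of these expanding maps, so a point
    outside I_beta stays outside. Hence an orbit ending in I_beta has never left it. *)
Lemma beta_map_Ibeta k x : Ibeta beta (beta_map k x) -> Ibeta beta x.
Proof.
rewrite !Ibeta_itv /beta_map subr_ge0 => /andP[kx xk]; apply/andP; split.
  by rewrite -(pmulr_rge0 _ beta_gt0) (le_trans _ kx).
rewrite -(ler_pM2l beta_gt0) LE; move: xk; rewrite lerBlDr => /le_trans; apply.
by rewrite lerD2l ler_nat -ltnS.
Qed.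

Lemma exists_beta_map_Ibeta x : Ibeta beta x ->
  exists k, Ibeta beta (beta_map k x).
Proof.
rewrite Ibeta_itv => /andP[x0 xL]; have L1 := Ibeta_length_gt1.
have bx0 : 0 <= beta * x by rewrite mulr_ge0// ltW.
have bxL : beta * x <= L + (Num.truncn beta)%:R by rewrite -LE ler_pM2l.
have /andP[tl tu] := truncn_itv bx0.
(* The greedy digit, capped at the largest one. Uncapped, the remainder is below 1 < L; capped, x <=
   L gives the upper bound. *)
have km : (minn (Num.truncn (beta * x)) (Num.truncn beta) <
    (Num.truncn beta).+1)%N.
  by rewrite ltnS geq_minr.
exists (Ordinal km); rewrite Ibeta_itv /beta_map /= subr_ge0 lerBlDr.
case: leqP => [_|lt]; move: tu; rewrite -natr1 => tu.
  by rewrite tl; lra.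
by rewrite bxL andbT (le_trans _ tl)// ler_nat ltnW.
Qed.

Lemma switch_region_beta_map x : switch_region x ->
  exists k k' : digit beta, [/\ k != k',
    Ibeta beta (beta_map k x) & Ibeta beta (beta_map k' x)].
Proof.
have m1 : (1 < (Num.truncn beta).+1)%N by rewrite ltnS truncn_gt0 ltW.
rewrite /switch_region /= in_itv/= ler_pdivlMr// mulrC => /andP[x1 xL].
have {}x1 : 1 <= beta * x.
  by rewrite -(ler_pM2l beta_gt0) in x1; rewrite mulfV ?gt_eqF in x1.
exists ord0, (Ordinal m1); split => //; rewrite Ibeta_itv /beta_map/=; lra.
Qed.

Lemma switch_region_Ibeta x : switch_region x -> Ibeta beta x.
Proof.
by move/switch_region_beta_map => [k [_ [_ + _]]]; exact: beta_map_Ibeta.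
Qed.

Lemma iter_beta_preimage_Ibeta n x :
  iter n beta_preimage switch_region x -> Ibeta beta x.
Proof.
elim: n x => [|n IH] x; first exact: switch_region_Ibeta.
by case=> k /IH; exact: beta_map_Ibeta.
Qed.

Let beta_preimageE (A : set R) : beta_preimage A =
  \big[setU/set0]_(k <- enum 'I_(Num.truncn beta).+1) (beta_map k @^-1` A).
Proof.
rewrite -bigcup_seq; apply/seteqP; split => x [k].
  by exists k => //=; rewrite mem_enum.
by move=> _ kx; exists k.
Qed.

(** * Almost every point can reach the switch region *)

Lemma negligible_beta_preimage (A : set R) :
  (@lebesgue_measure R).-negligible A ->
  (@lebesgue_measure R).-negligible (beta_preimage A).
Proof.
move=> nA; rewrite beta_preimageE; elim/big_ind : _ => //.
- exact: negligible_set0.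
- by move=> ? ?; exact: negligibleU.
- by move=> k _; exact: negligible_preimage_affine.
Qed.

Lemma measurable_iter_beta_preimage n :
  measurable (iter n beta_preimage switch_region : set (measurableTypeR R)).
Proof.
elim: n => [|n IH]; first exact: measurable_itv.
rewrite iterS beta_preimageE.
apply: bigsetU_measurable => k _; rewrite -[X in measurable X]setTI.
exact: measurable_affine.
Qed.

(** Pull the switch region back along n digits that keep x in I_beta: each step divides its length
    and its distances to x by beta. For n = 0 everything lies in I_beta, of length L. *)
Lemma near_switch_region n x : Ibeta beta x ->
  exists a b, [/\ b - a = (L - 1) / beta ^+ n.+1,
    `[a, b] `<=` iter n beta_preimage switch_region,
    `|a - x| <= L / beta ^+ n & `|b - x| <= L / beta ^+ n].
Proof.
have b0 : beta != 0 by rewrite gt_eqF.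
elim: n x => [|n IH] x Ix.
  have le_ab : beta^-1 <= L / beta.
    by rewrite ler_pdivlMr// mulVf// ltW// Ibeta_length_gt1.
  have dist_le y z : Ibeta beta y -> Ibeta beta z -> `|y - z| <= L / beta ^+ 0.
    by rewrite !Ibeta_itv expr0 divr1 => yL zL; rewrite ler_norml; lra.
  exists beta^-1, (L / beta); split => //.
  - by rewrite expr1; field.
  - apply: dist_le => //; apply: switch_region_Ibeta.
    by rewrite /switch_region /= in_itv /= lexx.
  - apply: dist_le => //; apply: switch_region_Ibeta.
    by rewrite /switch_region /= in_itv /= lexx andbT.
have [k /IH[a [b [ba ab ax bx]]]] := exists_beta_map_Ibeta Ix.
have pull y : `|y - beta_map k x| <= L / beta ^+ n ->
    `|(y + k%:R) / beta - x| <= L / beta ^+ n.+1.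
  have -> : (y + k%:R) / beta - x = (y - beta_map k x) / beta.
    by rewrite /beta_map; field.
  rewrite normrM (gtr0_norm (_ : 0 < beta^-1)) ?invr_gt0// => yx.
  by rewrite exprSr invfM mulrA ler_pM2r ?invr_gt0.
exists ((a + k%:R) / beta), ((b + k%:R) / beta); split.
- rewrite -mulrBl (_ : _ - _ = b - a); last by ring.
  by rewrite ba [in RHS]exprSr invfM mulrA.
- move=> y /=; rewrite in_itv/= ler_pdivrMr// ler_pdivlMr// => aby.
  by exists k; apply: ab; rewrite /= in_itv/= /beta_map; lra.
- exact: pull.
- exact: pull.
Qed.

Lemma negligible_never_switch :
  (@lebesgue_measure R).-negligible (beta_orbit_avoid switch_region).
Proof.
set V := beta_orbit_avoid _; have L1 := Ibeta_length_gt1.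
have L0 : 0 < L := lt_trans ltr01 L1.
have mV : measurable (V : set (measurableTypeR R)).
  apply: measurableD; first exact: measurable_itv.
  by apply: bigcupT_measurable => n; exact: measurable_iter_beta_preimage.
(* It suffices that no point of [V] is a density point of [V]. *)
apply: negligibleS (lebesgue_density mV) => x Vx /=.
rewrite indicE mem_set// => cvg1.
(* The proportion of a ball of radius 2 L beta^-n filled by the interval that
   near_switch_region provides. *)
pose d := (L - 1) / (4 * L * beta).
have d0 : 0 < d.
  by apply: divr_gt0; [rewrite subr_gt0|do 2!apply: mulr_gt0 => //].
have d1 : 1 - d < 1 by rewrite ltrBlDr ltrDl.
have /cvg1 /= := @nbhs_open_ereal_gt _ 1 (fun=> 1 - d) d1.
move=> -[e /= e0 He].
have rn0 : geometric (2 * L) beta^-1 @ \oo --> (0 : R).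
  by apply: cvg_geometric; rewrite gtr0_norm ?invr_gt0// invf_lt1.
have /cvgrPdist_lt/(_ _ e0) [n _ /(_ n (leqnn n))] := rn0.
rewrite sub0r normrN /= => rn.
(* Both ends of the interval lie within r / 2 of x, so the open ball of radius r contains it. *)
pose r := 2 * L * beta^-1 ^+ n.
have r0 : 0 < r.
  by apply: mulr_gt0; [exact: mulr_gt0|rewrite exprn_gt0 ?invr_gt0].
have := He r; rewrite /= sub0r normrN => /(_ rn r0).
rewrite lebesgue_measure_ball ?ltW//.
apply/negP; rewrite -leNgt.
have [a [b [ba ab ax bx]]] := near_switch_region n Vx.1.
have disj : [disjoint V `&` ball x r & `[a, b]%classic].
  apply/disj_setPLR => y [[_ Vy] _] /ab yn.
  by apply: Vy; exists n.
have abB : `[a, b] `<=` ball x r.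
  have Lr : L / beta ^+ n < r.
    by rewrite -exprVn /r ltr_pM2r ?exprn_gt0 ?invr_gt0//; lra.
  move=> y /=; rewrite in_itv/= ball_itv/= in_itv/=.
  move: ax bx; rewrite !ler_norml => ax bx; lra.
have ba_r : b - a = d * (r *+ 2).
  rewrite ba /d /r exprS invfM exprVn -mulr_natl; field.
  by rewrite expf_neq0 ?gt_eqF.
have mVB : measurable (V `&` ball x r : set (measurableTypeR R)).
  by apply: measurableI => //; exact: measurable_ball.
(* The interval is disjoint from [V], which leaves [V] at most a proportion 1 - d of the ball. *)
have le_VB : (lebesgue_measure (V `&` ball x r) + (b - a)%:E <= (r *+ 2)%:E)%E.
  have -> : ((b - a)%:E = lebesgue_measure `[a, b]%classic)%E.
    rewrite lebesgue_measure_itv/= lte_fin ifT//.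
    by rewrite -subr_gt0 ba_r mulr_gt0// pmulrn_lgt0.
  rewrite -(lebesgue_measure_ball x (ltW r0)) -measureU//; last first.
    exact/disj_set2P.
  apply: le_measure; rewrite ?inE//.
  - exact: measurableU.
  - exact: measurable_ball.
  - by rewrite subUset; split => // y [].
rewrite inver ifF; last by rewrite gt_eqF// pmulrn_lgt0.
rewrite lee_pdivrMr ?pmulrn_lgt0// -EFinM mulrBl mul1r -ba_r EFinB.
by rewrite leeBrDr.
Qed.

(** * Producing many expansions along orbits *)

Lemma beta_orbit_avoid_map N k x : beta_orbit_avoid N x ->
  Ibeta beta (beta_map k x) -> beta_orbit_avoid N (beta_map k x).
Proof.
move=> [_ xN] Ikx; split=> // -[n _ kxn]; apply: xN.
by exists n.+1 => //; exists k.
Qed.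

Section Expansions.
Variables (pup plow : digit beta -> R).

Lemma beta_expansion_scons k x (eps : nat -> digit beta) :
  beta_expansion (beta_map k x) eps -> beta_expansion x (scons k eps).
Proof.
rewrite /beta_expansion => cv; rewrite -cvg_shiftS.
rewrite [X in X @ \oo --> _](_ : _ = fun n => k%:R / beta +
    beta^-1 * series (fun i => (eps i)%:R * beta ^- i.+1) n).
  have -> : x = k%:R / beta + beta^-1 * beta_map k x.
    by rewrite /beta_map; field; rewrite gt_eqF.
  by apply: cvgD; [exact: cvg_cst|apply: cvgZl_tmp].
apply/funext => n; rewrite /series /= big_nat_recl//= expr1; congr (_ + _).
rewrite mulr_sumr; apply: eq_bigr => i _.
by rewrite (exprS _ i.+1) invfM mulrCA.
Qed.

Lemma beta_expansions_of_frequency_scons k x eps :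
  beta_expansions_of_frequency pup plow (beta_map k x) eps ->
  beta_expansions_of_frequency pup plow x (scons k eps).
Proof.
move=> [/beta_expansion_scons xe /of_frequency_scons fr].
by split; last exact: fr.
Qed.

Lemma at_least_scons n k x :
  at_least n (beta_expansions_of_frequency pup plow (beta_map k x)) ->
  at_least n (beta_expansions_of_frequency pup plow x).
Proof.
move=> [s [us sn sE]]; exists (map (scons k) s); split.
- by rewrite map_inj_uniq//; exact: scons_inj.
- by rewrite size_map.
- by move=> _ /mapP[e es ->]; exact/beta_expansions_of_frequency_scons/sE.
Qed.

(** Outer induction on the number of expansions, inner induction on the number of steps to the
    switch region. Good points remain good along orbits in I_beta, so both hypotheses apply to
    images. *)
Lemma at_least_beta_expansions N :
  (forall x, Ibeta beta x -> ~ N x ->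
    (exists eps, beta_expansions_of_frequency pup plow x eps) /\
    (\bigcup_n iter n beta_preimage switch_region) x) ->
  forall n x, beta_orbit_avoid N x ->
    at_least n (beta_expansions_of_frequency pup plow x).
Proof.
move=> goodN n; have good x : beta_orbit_avoid N x ->
    (exists eps, beta_expansions_of_frequency pup plow x eps) /\
    (\bigcup_n iter n beta_preimage switch_region) x.
  by move=> [Ix xN]; apply: goodN => // Nx; apply: xN; exists 0%N.
elim: n => [x _|n IH x Ax]; first by exists [::].
have [_ [j _]] := good x Ax.
elim: j x Ax => [|j IHj] x Ax.
  move/switch_region_beta_map => [k [k' [kk' kx k'x]]].
  have [s [us sn sE]] := IH _ (beta_orbit_avoid_map Ax kx).
  have [[e eE] _] := good _ (beta_orbit_avoid_map Ax k'x).
  (* The n expansions through k are joined by one through k', which differs from them in its first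
     digit. *)
  exists (scons k' e :: map (scons k) s); split => /=.
  - rewrite map_inj_uniq ?us ?andbT; last exact: scons_inj.
    apply/mapP => -[e' _ /funeqP/(_ 0%N)/= k'k].
    by rewrite k'k eqxx in kk'.
  - by rewrite size_map sn.
  - move=> f /=; rewrite inE => /predU1P[->|/mapP[e' es ->]];
      apply: beta_expansions_of_frequency_scons => //; exact: sE.
case=> k kx; apply: (at_least_scons (k := k)); apply: IHj => //.
exact: beta_orbit_avoid_map (iter_beta_preimage_Ibeta kx).
Qed.

End Expansions.
End BetaMaps.

Theorem theorem1p1 (R : realType) (beta : R)
    (beta_gt1 : 1 < beta) (beta_nonint : beta \isn't a Num.nat)
    (pup plow : digit beta -> R)
    (pup01 : forall k, 0 <= pup k <= 1)
    (plow01 : forall k, 0 <= plow k <= 1) :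
  {ae @lebesgue_measure R, forall x, Ibeta beta x ->
     exists eps, beta_expansions_of_frequency pup plow x eps} <->
  {ae @lebesgue_measure R, forall x, Ibeta beta x ->
     infinite_set (beta_expansions_of_frequency pup plow x)}.
Proof.
split=> [ex_ae|]; last first.
  apply: negligibleS; apply: subsetC => x /= inf Ix.
  exact: infinite_setN0 (inf Ix).
pose G := ~` [set x | Ibeta beta x ->
  exists eps, beta_expansions_of_frequency pup plow x eps].
(* [N] collects both defects: having no expansion of the given frequency, and never reaching the
   switch region. *)
pose N := G `|` beta_orbit_avoid beta (switch_region beta).
have nN : (@lebesgue_measure R).-negligible N.
  by apply: negligibleU => //; exact: negligible_never_switch.
(* Adding all points with some orbit meeting [N] keeps the set null; every other point of I_beta is
   good. *)
have nNs : (@lebesgue_measure R).-negligible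
    (\bigcup_n iter n (beta_preimage beta) N).
  apply: negligible_bigcup; elim=> [//|n IH].
  exact: negligible_beta_preimage.
apply: negligibleS nNs; apply: subsetCl => x Nx /= Ix.
apply: infinite_at_least => n.
apply: (at_least_beta_expansions beta_gt1 (N := N)) => // y Iy.
move=> /not_orP[Gy Vy]; split.
  by move: Gy; rewrite /G /= => /contrapT; exact.
by apply: contrapT => yn; apply: Vy.
Qed.
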